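(* Let $n>2$ and $t>2$ be two positive integers. Then \[\varphi(C_n \boxdot P_t)=\begin{cases} 5, & \text{if } n\in\{3,4\},\\ n, & \text{if } 5\leq n\leq 2t+2,\\ 2t+3, & \text{otherwise}. \end{cases}\]
   Context: All graphs are finite and simple. $P_n$ and $C_n$ denote respectively the path and the cycle with $n$ vertices. The subdivision graph $S(G)$ of a graph $G$ is obtained by inserting one new vertex into every edge of $G$. For graphs $G$ and $H$, with $V(G)=\{u_0,\ldots,u_{m-1}\}$, the subdivision-vertex neighbourhood corona (SVN corona) $G\boxdot H$ is the graph obtained from $S(G)$ by adding $m$ vertex-disjoint copies of $H$ (one for each $u_i$) and joining, for each $i$, every vertex of $N_{S(G)}(u_i)$ (the neighbourhood of $u_i$ in $S(G)$) to every vertex of the copy of $H$ associated with $u_i$. A $b$-chromatic coloring of a graph with $k$ colors is a proper coloring with colors $0,\ldots,k-1$ such that, for each color $i$, there is a vertex (a $b$-vertex) of color $i$ having, for each color $j\neq i$, a neighbour of color $j$. The $b$-chromatic number $\varphi(G)$ is the maximum $k$ for which $G$ has a $b$-chromatic coloring with $k$ colors. *)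

(* Defs.v *)
From mathcomp Require Import all_boot.

Set Implicit Arguments.
Unset Strict Implicit.
Unset Printing Implicit Defensive.

Record sgraph := SGraph {
  svertex :> finType;
  sedge : rel svertex;
  sedge_sym : symmetric sedge;
  sedge_irrefl : irreflexive sedge }.

Notation "x -- y" := (sedge x y) (at level 30).

Section PathCycle.
Variable n : nat.

Definition path_edge : rel 'I_n := fun i j => (i.+1 == j) || (j.+1 == i).

Lemma path_edge_sym : symmetric path_edge.
Proof. by move=> i j; rewrite /path_edge orbC. Qed.

Lemma path_edge_irrefl : irreflexive path_edge.
Proof. by move=> i; rewrite /path_edge orbb eqn_leq ltnn. Qed.

Definition path_graph := SGraph path_edge_sym path_edge_irrefl.

(* This is the n-vertex cycle for 2 < n; the conjunct i != j only matters for
   n = 1, where it removes the loop. *)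
Definition cycle_edge : rel 'I_n :=
  fun i j => (i != j) && ((i.+1 == j %[mod n]) || (j.+1 == i %[mod n])).

Lemma cycle_edge_sym : symmetric cycle_edge.
Proof. by move=> i j; rewrite /cycle_edge eq_sym orbC. Qed.

Lemma cycle_edge_irrefl : irreflexive cycle_edge.
Proof. by move=> i; rewrite /cycle_edge eqxx. Qed.

Definition cycle_graph := SGraph cycle_edge_sym cycle_edge_irrefl.

End PathCycle.

Section Subdivision.
Variable G : sgraph.

Definition is_edge (A : {set G}) : bool :=
  [exists x : G, exists y : G, (x -- y) && (A == [set x; y])].

Definition edge_type := {A : {set G} | is_edge A}.

(* inl u is the original vertex u, inr A the vertex inserted into the edge A. *)
Definition subdiv_edge : rel (G + edge_type) :=
  fun a b => match a, b with
  | inl u, inr A | inr A, inl u => u \in val A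
  | _, _ => false
  end.

Lemma subdiv_edge_sym : symmetric subdiv_edge.
Proof. by case=> [u|A] [v|B]. Qed.

Lemma subdiv_edge_irrefl : irreflexive subdiv_edge.
Proof. by case. Qed.

Definition subdivision := SGraph subdiv_edge_sym subdiv_edge_irrefl.

End Subdivision.

Section Corona.
Variables G H : sgraph.

(* inl a is the vertex a of the subdivision graph of G, and inr (u, x) is the
   vertex x of the copy of H associated with the vertex u of G. *)
Definition svn_edge : rel (subdivision G + G * H) :=
  fun a b => match a, b with
  | inl s, inl s' => s -- s'
  | inl s, inr (u, _) | inr (u, _), inl s => (inl u : subdivision G) -- s
  | inr (u, x), inr (v, y) => (u == v) && (x -- y)
  end.

Lemma svn_edge_sym : symmetric svn_edge.
Proof.
case=> [s|[u x]] [s'|[v y]] //=; first exact: subdiv_edge_sym.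
by rewrite eq_sym sedge_sym.
Qed.

Lemma svn_edge_irrefl : irreflexive svn_edge.
Proof.
case=> [s|[u x]] /=; first exact: subdiv_edge_irrefl.
by rewrite sedge_irrefl andbF.
Qed.

Definition svn_corona := SGraph svn_edge_sym svn_edge_irrefl.

End Corona.

Section BChromatic.
Variable G : sgraph.

Definition proper_coloring k (f : {ffun G -> 'I_k}) : bool :=
  [forall x : G, forall y : G, (x -- y) ==> (f x != f y)].

Definition b_vertex k (f : {ffun G -> 'I_k}) (i : 'I_k) (v : G) : bool :=
  (f v == i) &&
  [forall j : 'I_k, (j != i) ==> [exists w : G, (v -- w) && (f w == j)]].

Definition b_coloring k (f : {ffun G -> 'I_k}) : bool :=
  proper_coloring f && [forall i : 'I_k, exists v : G, b_vertex f i v].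

Definition b_colorable k : bool :=
  [exists f : {ffun G -> 'I_k}, b_coloring f].

(* The range k <= #|G| loses nothing, by b_colorable_card. *)
Definition b_chromatic_number : nat :=
  \max_(k < #|G|.+1 | b_colorable k) k.

Lemma b_colorable_card k : b_colorable k -> k <= #|G|.
Proof.
case/existsP=> f /andP[_ /forallP fb].
rewrite -[k]card_ord -(_ : #|codom f| = #|'I_k|) ?leq_image_card //.
apply: eq_card => i; rewrite !inE.
by have /existsP[v /andP[/eqP <- _]] := fb i; rewrite codom_f.
Qed.

Lemma b_chromatic_number_max k : b_colorable k -> k <= b_chromatic_number.
Proof.
move=> kb; have klt : k < #|G|.+1 by rewrite ltnS b_colorable_card.
exact: (@leq_bigmax_cond _ _ (fun i : 'I_#|G|.+1 => i : nat) (Ordinal klt)).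
Qed.

End BChromatic.

(* Main.v *)
(* Write e_i for the vertex inserted into the edge {i, i+1} of the cycle, and
   call the original vertex i and the copy of the path attached to it group i;
   thus e_i is joined exactly to the groups i and i+1.

   With k > 5 colors a b-vertex has degree at least 5, so it is some e_i, of
   degree 2t+2; hence k <= 2t+3, and k <= n because the k colors need k distinct
   b-vertices among the n vertices e_i.

   For k = min(n, 2t+3) >= 5 the b-vertices are e_0, ..., e_(k-1): e_i gets
   color i and group i the colors i + d mod k with d in {1, 3, 5, ...},
   d < k - 1, plus d = k - 2 when k is even. Group i+1 then shows the remaining
   colors to e_i, and there are only k/2 <= t+1 values of d. When n > k, every
   further e_i repeats the color k-1 and every further group the colors of
   group 0. When n <= 4, colors n, ..., 4 have their b-vertices inside the
   paths. *)
Require Import Defs.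
From mathcomp Require Import all_boot.
From mathcomp Require Import zify.
Set Implicit Arguments.
Unset Strict Implicit.
Unset Printing Implicit Defensive.

(** * b-colorings of arbitrary graphs *)

Lemma b_chromatic_number_eq (G : sgraph) k :
  b_colorable G k -> (forall l, b_colorable G l -> l <= k) ->
  b_chromatic_number G = k.
Proof.
move=> kb kmax; apply/eqP; rewrite eqn_leq b_chromatic_number_max // andbT.
by apply/bigmax_leqP => i /kmax.
Qed.

Lemma b_colorable_nat (G : sgraph) k (F : G -> nat) :
    (forall v, F v < k) ->
    (forall x y, x -- y -> F x <> F y) ->
    (forall i, i < k -> exists2 v, F v = i &
       forall j, j < k -> j <> i -> exists2 w, v -- w & F w = j) ->
  b_colorable G k.
Proof.
move=> Fk Fproper Fb.
apply/existsP; exists [ffun v => Ordinal (Fk v)]; apply/andP; split.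
  apply/forallP=> x; apply/forallP=> y; apply/implyP=> xy.
  by rewrite !ffunE -val_eqE /=; apply/eqP/Fproper.
apply/forallP=> i; have [v Fv vb] := Fb i (ltn_ord i).
apply/existsP; exists v; rewrite /b_vertex ffunE -val_eqE /= Fv eqxx /=.
apply/forallP=> j; apply/implyP=> ji.
have [|w vw Fw] := vb j (ltn_ord j); first by apply/eqP; rewrite val_eqE.
by apply/existsP; exists w; rewrite vw ffunE -val_eqE /= Fw eqxx.
Qed.

(** The color [i] and the colors along [s] exhaust all [k] colors. Since [s] may repeat vertices or
    contain non-neighbours, no exact degree is needed. *)
Lemma b_vertex_neighbours (G : sgraph) k (f : {ffun G -> 'I_k}) i v (s : seq G) :
  b_vertex f i v -> (forall w, v -- w -> w \in s) -> k <= (size s).+1.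
Proof.
case/andP=> /eqP fv /forallP vb vs.
rewrite -[k]card_ord -(size_map f s).
apply: leq_trans (_ : #|i :: map f s| <= _); last exact: card_size.
apply/subset_leq_card/subsetP=> j _; rewrite inE.
case: eqVneq => //= ji; have /implyP/(_ ji)/existsP[w /andP[/vs ws /eqP <-]] := vb j.
exact: map_f.
Qed.

Lemma ordS_nat n (i : 'I_n) : ordS i = (if i.+1 == n then 0 else i.+1) :> nat.
Proof.
rewrite /=; case: eqP => [->|ni]; first by rewrite modnn.
by rewrite modn_small //; have := ltn_ord i; lia.
Qed.

(** The converse fails at the ends of the path, where [ordS] and [ord_pred] wrap around; listing at
    most two candidate neighbours suffices for a degree bound. *)
Lemma path_edgeP n (x y : 'I_n) : path_edge x y -> y = ordS x \/ y = ord_pred x.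
Proof.
case/orP=> /eqP xy; [left | right; rewrite -[y]ordSK; congr ord_pred];
  by apply: val_inj; rewrite /= xy modn_small.
Qed.

(** * Indexing the edges of the cycle by its vertices *)

Section CycleEdges.

Variable n : nat.
Hypothesis n_gt2 : 2 < n.

Lemma cycle_edge_ordS (i : 'I_n) : (i : cycle_graph n) -- ordS i.
Proof.
rewrite /sedge /= /cycle_edge modn_mod eqxx andbT.
by rewrite -val_eqE [X in _ != X]ordS_nat /=; have := ltn_ord i; case: (i.+1 =P n); lia.
Qed.

Lemma is_edge_ordS (i : 'I_n) : is_edge (G := cycle_graph n) [set i; ordS i].
Proof.
apply/existsP; exists i; apply/existsP; exists (ordS i).
by rewrite cycle_edge_ordS eqxx.
Qed.

Definition edge_at (i : 'I_n) : edge_type (cycle_graph n) :=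
  exist _ [set i; ordS i] (is_edge_ordS i).

Lemma edge_index_exists (A : edge_type (cycle_graph n)) :
  exists i, edge_at i == A.
Proof.
case: A => A eA; have /existsP[x /existsP[y /andP[xy /eqP defA]]] := eA.
case/andP: xy => _ /orP[] /eqP; rewrite [RHS]modn_small // => xy.
  have yS : y = ordS x by apply: val_inj.
  by exists x; rewrite -val_eqE /= defA yS.
have xS : x = ordS y by apply: val_inj.
by exists y; rewrite -val_eqE /= defA xS setUC.
Qed.

Definition edge_index A := xchoose (edge_index_exists A).

Lemma edge_indexK : cancel edge_index edge_at.
Proof. by move=> A; apply/eqP/(xchooseP (edge_index_exists A)). Qed.

Lemma mem_edge_at (u i : 'I_n) : u \in val (edge_at i) = (u == i) || (u == ordS i).
Proof. by rewrite !inE. Qed.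

(** If distinct [i] and [j] gave the same edge, each would be the successor of the other, so 2 would
    be 0 modulo [n]. *)
Lemma edge_at_inj : injective edge_at.
Proof.
move=> i j eij; apply: val_inj.
have : i \in val (edge_at j) by rewrite -eij mem_edge_at eqxx.
have : j \in val (edge_at i) by rewrite eij mem_edge_at eqxx.
rewrite !mem_edge_at -!(inj_eq val_inj) ![val (ordS _)]ordS_nat => ji ij.
move: ji ij => /=; have := ltn_ord i; have := ltn_ord j.
by case: (i.+1 =P n); case: (j.+1 =P n); lia.
Qed.

Lemma edge_atK : cancel edge_at edge_index.
Proof. by move=> i; apply/edge_at_inj; rewrite edge_indexK. Qed.

Lemma edge_at_mem (u : 'I_n) (A : edge_type (cycle_graph n)) :
  u \in val A -> A = edge_at u \/ A = edge_at (ord_pred u).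
Proof.
rewrite -[A]edge_indexK mem_edge_at.
by case/orP=> /eqP ->; [left | right; rewrite ordSK].
Qed.

End CycleEdges.

(** * Degrees in the corona and the upper bound *)

Section Corona.

Variables n t : nat.
Hypotheses (n_gt2 : 2 < n) (t_gt2 : 2 < t).

Local Notation G := (svn_corona (cycle_graph n) (path_graph t)).
Local Notation edge_at := (edge_at n_gt2).
Local Notation original u := (inl (inl u) : G).
Local Notation inserted i := (inl (inr (edge_at i)) : G).

(** An original vertex has degree 2 and a path vertex at most 4, so a b-vertex of either kind forces
    [k <= 5]. *)
Lemma b_vertex_cases k (f : {ffun G -> 'I_k}) i v : b_vertex f i v ->
  k <= 5 \/ k <= 2 * t + 3 /\ exists e, f (inserted e) = i.
Proof.
case: v => [[u|A]|[u x]] fv.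
- left; apply: leq_trans (b_vertex_neighbours (s :=
    [:: inserted u; inserted (ord_pred u)]) fv _) _ => //.
  by move=> [[w|A]|[w y]] //= /(edge_at_mem n_gt2) [] ->; rewrite !inE eqxx ?orbT.
- right; rewrite -[A](edge_indexK n_gt2) in fv.
  move: (edge_index _ A) fv => e fv; split; last first.
    by exists e; apply/eqP; case/andP: fv.
  have szI : size (enum 'I_t) = t by exact: size_enum_ord.
  have memI x : x \in enum 'I_t by rewrite mem_enum.
  move: (enum _) szI memI => I szI memI.
  apply: leq_trans (b_vertex_neighbours (s :=
    [:: original e, original (ordS e) &
        [seq (inr (e, x) : G) | x <- I] ++
        [seq (inr (ordS e, x) : G) | x <- I]]) fv _) _; last first.
    by rewrite /= size_cat !size_map szI; lia.
  move=> [[w|B]|[w y]] //; rewrite /sedge /= !inE => /orP[] /eqP ->;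
    rewrite ?eqxx ?orbT // mem_cat map_f ?orbT //.
- left; apply: leq_trans (b_vertex_neighbours (s :=
    [:: inserted u; inserted (ord_pred u); inr (u, ordS x); inr (u, ord_pred x)])
    fv _) _ => //.
  move=> [[w|A]|[w y]] //=.
    by case/(edge_at_mem n_gt2) => ->; rewrite !inE eqxx ?orbT.
  by case/andP=> /eqP <- /path_edgeP [] ->; rewrite !inE eqxx ?orbT.
Qed.

Lemma b_colorable_bound k : b_colorable G k -> 5 < k -> k <= minn n (2 * t + 3).
Proof.
case/existsP=> f /andP[_ /forallP fb] k_gt5.
have fe i : k <= 2 * t + 3 /\ exists e, f (inserted e) = i.
  by have /existsP[v /b_vertex_cases []] := fb i; first lia.
rewrite leq_min (proj1 (fe (Ordinal k_gt5))) andbT.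
rewrite -[k]card_ord -[leqRHS]card_ord.
apply: leq_trans (leq_image_card (fun e => f (inserted e)) _).
apply/subset_leq_card/subsetP=> i _.
by have [_ [e <-]] := fe i; apply: image_f.
Qed.

(** * An arithmetic criterion for b-colorability *)

Section Coloring.

Variables (k : nat) (c h : nat -> nat) (g : nat -> nat -> nat).

Definition corona_color (v : G) : nat :=
  match v with
  | inl (inl u) => h (u : 'I_n)
  | inl (inr A) => c (edge_index n_gt2 A)
  | inr (u, x) => g (u : 'I_n) (x : 'I_t)
  end.

(** All vertices of a group have the same neighbours among the inserted vertices, so an inserted
    vertex depends only on the set of colors of a group. *)
Definition group_color i l := h i = l \/ exists2 x, x < t & g i x = l.

Hypotheses (c_lt : forall i, i < n -> c i < k)
  (group_lt : forall i l, i < n -> group_color i l -> l < k)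
  (c_group : forall i, i < n -> ~ group_color i (c i))
  (c_groupS : forall i, i < n -> ~ group_color (i.+1 %% n) (c i))
  (g_proper : forall i x, i < n -> x.+1 < t -> g i x <> g i x.+1).

Definition edge_b_color j := exists i, [/\ i < n, c i = j &
  forall l, l < k -> l <> j -> group_color i l \/ group_color (i.+1 %% n) l].

(* Indexing by i.+1 avoids the wrap-around at group 0. *)
Definition path_b_color j := exists i x, [/\ i.+1 < n, x.+2 < t, g i.+1 x.+1 = j &
  forall l, l < k -> l <> j -> l \in [:: c i; c i.+1; g i.+1 x; g i.+1 x.+2]].

Lemma group_original (u : 'I_n) : group_color u (corona_color (original u)).
Proof. by left. Qed.

Lemma group_path (u : 'I_n) (x : 'I_t) :
  group_color u (corona_color (inr (u, x) : G)).
Proof. by right; exists x. Qed.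

Lemma group_colorP (u : 'I_n) l : group_color u l ->
  exists2 w : G, corona_color w = l &
    forall e, u \in val (edge_at e) -> inserted e -- w.
Proof.
case=> [<-|[x xt <-]]; first by exists (original u).
by exists (inr (u, Ordinal xt)).
Qed.

Lemma corona_colorE e : corona_color (inserted e) = c e.
Proof. by rewrite /= edge_atK. Qed.

Lemma inserted_group e (u : 'I_n) l : u \in val (edge_at e) ->
  group_color u l -> c e <> l.
Proof.
rewrite mem_edge_at => /orP[] /eqP -> ul ce; rewrite -ce in ul.
  exact: c_group ul.
exact: c_groupS ul.
Qed.

(** An original vertex is not adjacent to its own copy of the path. Every edge therefore joins an
    inserted vertex to a group or lies inside one path, and [c_group], [c_groupS] and [g_proper]
    cover these cases. *)
Lemma corona_colorable :
  (forall j, j < k -> edge_b_color j \/ path_b_color j) -> b_colorable G k.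
Proof.
move=> bcol; apply: (b_colorable_nat (F := corona_color)).
- move=> [[u|A]|[u x]]; first exact: group_lt (group_original u).
    exact: c_lt.
  exact: group_lt (group_path u x).
- have path_ne (u : 'I_n) (x y : 'I_t) : path_edge x y -> g u x <> g u y.
    case/orP=> /eqP xy; first by rewrite -xy; apply: g_proper; rewrite ?xy.
    by rewrite -xy => /esym; apply: g_proper; rewrite ?xy.
  have ins_ne (A : edge_type (cycle_graph n)) (u : 'I_n) l : u \in val A -> group_color u l ->
      corona_color (inl (inr A) : G) <> l.
    by rewrite -[A](edge_indexK n_gt2) corona_colorE; apply: inserted_group.
  move=> [[u|A]|[u x]] [[v|B]|[v y]] //.
  + by move=> uB /esym; apply: ins_ne uB (group_original u).
  + by move=> vA; apply: ins_ne vA (group_original v).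
  + by move=> vA; apply: ins_ne vA (group_path v y).
  + by move=> uB /esym; apply: ins_ne uB (group_path u x).
  + by case/andP=> /eqP <-; apply: path_ne.
move=> j /bcol [[i [i_lt ci near]] | [i [x [i_lt x_lt gj near]]]].
  exists (inserted (Ordinal i_lt)); first by rewrite corona_colorE.
  move=> l lk /(near l lk) [].
    case/(@group_colorP (Ordinal i_lt)) => w wl adj; exists w => //.
    by apply: adj; rewrite mem_edge_at eqxx.
  case/(@group_colorP (ordS (Ordinal i_lt))) => w wl adj; exists w => //.
  by apply: adj; rewrite mem_edge_at eqxx orbT.
have x1_lt : x.+1 < t by lia.
have x0_lt : x < t by lia.
have i0_lt : i < n by lia.
pose u := Ordinal i_lt; pose p y : G := inr (u, y).
exists (p (Ordinal x1_lt)) => // l lk /(near l lk).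
rewrite !inE => /or4P[] /eqP ->.
- exists (inserted (Ordinal i0_lt)); last by rewrite corona_colorE.
  rewrite /sedge /= mem_edge_at //; apply/orP; right; apply/eqP/val_inj.
  by rewrite [RHS]ordS_nat /= (ltn_eqF i_lt).
- exists (inserted u); last by rewrite corona_colorE.
  by rewrite /sedge /= mem_edge_at // eqxx.
- exists (p (Ordinal x0_lt)) => //.
  by rewrite /sedge /= eqxx /= /sedge /= /path_edge eqxx orbT.
- exists (p (Ordinal x_lt)) => //.
  by rewrite /sedge /= eqxx /= /sedge /= /path_edge eqxx.
Qed.

End Coloring.
End Corona.

(** * The coloring for [4 < n] *)

Lemma modn_add_eqP k r s j : r < k -> s < k -> j < k ->
  ((r + s) %% k == j) = (r + s == j) || (r + s == j + k).
Proof.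
move=> rk sk jk; have [lt|ge] := ltnP (r + s) k.
  by rewrite modn_small //; lia.
by rewrite -(subnK ge) modnDr modn_small; lia.
Qed.

Lemma corona_colorable_long n t (n_gt2 : 2 < n) (t_gt2 : 2 < t) :
  4 < n ->
  b_colorable (svn_corona (cycle_graph n) (path_graph t)) (minn n (2 * t + 3)).
Proof.
move=> n_gt4.
have : [/\ 4 < minn n (2 * t + 3), minn n (2 * t + 3) <= 2 * t + 3
  & minn n (2 * t + 3) <= n] by split; lia.
move: (minn _ _) => k [k_gt4 k_le k_le_n].
pose m := k./2; pose r i := if i < k then i else 0.
(* [s] enumerates the differences d. The cap changes only the last one, for even [k], from [k - 1]
   to [k - 2]. *)
pose s j := minn (2 * j).+1 (k - 2); pose a i j := (r i + s j) %% k.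
have m_gt1 : 1 < m by rewrite /m; lia.
have m_le : m <= t.+1 by rewrite /m; lia.
have r_lt i : r i < k by rewrite /r; case: ifP; lia.
have s_lt j : s j < k by rewrite /s; lia.
have aE i j l : l < k -> (a i j == l) = (r i + s j == l) || (r i + s j == l + k).
  by move=> lk; rewrite /a modn_add_eqP.
(* When [m] is [t + 1] the path is one vertex too short for all differences, so the original vertex
   takes the last one. *)
pose c i := minn i k.-1; pose h i := a i m.-1; pose g i x := a i (x %% m).
have mod_lt x : x %% m < m by rewrite ltn_mod; lia.
have groupP i l : group_color t h g i l <-> exists2 j, j < m & a i j = l.
  split=> [[<-|[x _ <-]]|[j jm <-]].
  - by exists m.-1; first lia.
  - by exists (x %% m).
  have [jm1|jm1] := ltnP j m.-1; last by left; rewrite /h; congr a; lia.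
  by right; exists j; rewrite /g ?modn_small //; lia.
have a_inj i j j' : j < m -> j' < m -> a i j = a i j' -> j = j'.
  move=> jm jm' /eqP; rewrite eqn_modDl !modn_small // => /eqP.
  by rewrite /s; move: jm jm'; rewrite /m; lia.
apply: (corona_colorable n_gt2 t_gt2 (c := c) (h := h) (g := g)).
- by move=> i; rewrite /c; lia.
- by move=> i l _ /groupP[j _ <-]; rewrite /a ltn_mod; lia.
(* Every difference lies strictly between 0 and [k - 1]: avoiding 0 keeps the color of e_i out of
   group i, and avoiding [k - 1] keeps it out of group i+1. *)
- move=> i i_lt /groupP[j jm] /eqP; rewrite aE /c /r; last lia.
  by rewrite /s; case: ifP; lia.
- move=> i i_lt /groupP[j jm] /eqP; rewrite aE /c /r; last lia.
  have [iSn|iSn] := eqVneq i.+1 n.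
    by rewrite iSn modnn /s; case: ifP; lia.
  by rewrite modn_small /s; last lia; case: ifP; lia.
- move=> i x _ _ /(a_inj _ _ _ (mod_lt _) (mod_lt _)) /eqP.
  by rewrite -[x in x %% _]addn0 -addn1 eqn_modDl mod0n modn_small.
move=> j jk; left; exists j; split; [lia | by rewrite /c; lia|].
move=> l lk lj.
have rj : r j = j by rewrite /r jk.
(* Past e_(k-1) comes a group colored as group 0, either by wrap-around or because group k copies
   it. *)
have rjS : r (j.+1 %% n) = if j.+1 == k then 0 else j.+1.
  rewrite /r; have [jSn|jSn] := eqVneq j.+1 n.
    by rewrite -jSn modnn; do 2 case: ifP; lia.
  by rewrite modn_small; last lia; do 2 case: ifP; lia.
pose d := if j < l then l - j else l + k - j.
have dP : 0 < d < k /\ (j + d == l) || (j + d == l + k).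
  by rewrite /d; case: ifP; lia.
(* Relative to group j+1 the difference is [d - 1]. It is odd for even [d]; for [d = k - 1] odd, it
   is the capped value [k - 2]. *)
have [d_odd|d_even] := boolP (odd d && (d < k.-1)); [left | right];
  apply/groupP.
  exists d./2; first by rewrite /m; lia.
  by apply/eqP; rewrite aE // rj /s; lia.
exists (d.-1)./2; first by rewrite /m; lia.
by apply/eqP; rewrite aE // rjS /s; case: ifP; lia.
Qed.

(** * Five colors for [n] equal to 3 or 4 *)

Lemma corona_colorable_short n t (n_gt2 : 2 < n) (t_gt2 : 2 < t) :
  n <= 4 -> b_colorable (svn_corona (cycle_graph n) (path_graph t)) 5.
Proof.
move=> n_le4.
(* L lists the colors of each group; every path repeats them with period 3. *)
pose L := if n == 3 then [:: [:: 1; 3; 4]; [:: 2; 4; 3]; [:: 0; 3; 4]]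
  else [:: [:: 1; 4; 2]; [:: 2; 4; 3]; [:: 0; 3; 4]; [:: 0; 1; 4]].
pose g i x := nth 0 (nth [::] L i) (x %% 3).
(* The original vertex may repeat a color of its path, the two being non-adjacent. *)
pose h i := g i 0.
have groupP i l : i < n -> group_color t h g i l <-> l \in nth [::] L i.
  have szL : i < n -> size (nth [::] L i) = 3.
    by rewrite /L; case: eqP => [->|_] {g h}; move: i => [|[|[|[|i]]]] //; lia.
  move=> /szL sz; split=> [[<-|[x _ <-]]|/(nthP 0)[x]].
  - by rewrite mem_nth ?sz.
  - by rewrite mem_nth ?sz ?ltn_mod.
  by rewrite sz => x_lt <-; right; exists x; rewrite /g ?modn_small //; lia.
have nP : n = 3 \/ n = 4 by lia.
apply: (corona_colorable n_gt2 t_gt2 (c := id) (h := h) (g := g)).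
- by move=> i; lia.
- move=> i l i_lt /groupP-/(_ i_lt); rewrite /L.
  by case: nP i_lt => -> /=; case: i => [|[|[|[|i]]]] //= _; rewrite !inE; lia.
- move=> i i_lt /groupP-/(_ i_lt); rewrite /L.
  by case: nP i_lt => -> /=; case: i => [|[|[|[|i]]]].
- move=> i i_lt /groupP-/(_ (ltn_pmod _ (ltnW (ltnW n_gt2)))); rewrite /L.
  by case: nP i_lt => -> /=; case: i => [|[|[|[|i]]]].
- move=> i x i_lt _; rewrite /g (_ : x.+1 %% 3 = (x %% 3).+1 %% 3); last lia.
  rewrite /L.
  have := ltn_pmod x (isT : 0 < 3); move: (x %% 3) => y y_lt.
  by case: nP i_lt => -> /=; case: i => [|[|[|[|i]]]] // _;
    case: y y_lt => [|[|[|y]]].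
have ends_lt i : i < n -> i.+1 %% n < n by move=> _; rewrite ltn_pmod; lia.
have edge_b i : i < n ->
    (forall l, l < 5 -> l <> i -> l \in nth [::] L i ++ nth [::] L (i.+1 %% n)) ->
    edge_b_color n t 5 id h g i.
  move=> i_lt near; exists i; split=> // l lk li; have := near l lk li.
  by rewrite mem_cat => /orP[] ?; [left | right]; apply/groupP => //; apply: ends_lt.
have path_b i l : i.+1 < n -> g i.+1 1 = l ->
    (forall j, j < 5 -> j <> l -> j \in [:: i; i.+1; g i.+1 0; g i.+1 2]) ->
    path_b_color n t 5 id g l.
  by move=> i_lt gl near; exists i, 0; split.
move=> j j_lt; have [j_n|n_j] := ltnP j n.
  left; apply: edge_b => //; rewrite /L.
  by case: nP j_n => -> /=; case: j {j_lt} => [|[|[|[|j]]]] // _;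
    case=> [|[|[|[|[|l]]]]].
(* Color 3, when [n = 3], has its b-vertex in group 2, between path colors 0 and 4; color 4 has it
   in group 1, between 2 and 3. The two adjacent inserted vertices supply the other two colors. *)
right; have [j3|j_ne3] := eqVneq j 3.
  have n3 : n = 3 by lia.
  rewrite j3.
  apply: (path_b 1); [lia | |]; rewrite /g /L n3 //=.
  by case=> [|[|[|[|[|l]]]]].
have -> : j = 4 by lia.
apply: (path_b 0); [lia | |]; rewrite /g /L; case: nP => -> //=;
  by case=> [|[|[|[|[|l]]]]].
Qed.

Theorem theorem11 (n t : nat) (hn : 2 < n) (ht : 2 < t) :
  b_chromatic_number (svn_corona (cycle_graph n) (path_graph t)) =
  if (n == 3) || (n == 4) then 5
  else if 5 <= n <= 2 * t + 2 then n
  else 2 * t + 3.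
Proof.
have -> : (if (n == 3) || (n == 4) then 5
  else if 5 <= n <= 2 * t + 2 then n else 2 * t + 3) =
  if n <= 4 then 5 else minn n (2 * t + 3).
  by do ?case: ifP; lia.
apply: b_chromatic_number_eq.
  have [|n_gt4] := leqP n 4; first exact: corona_colorable_short.
  exact: corona_colorable_long.
(* For [n <= 4], having [l > 5] contradicts the bound [l <= n]; for larger [n] the claimed value is
   at least 5. *)
move=> l lb; have [l_le5|l_gt5] := leqP l 5; first by case: ifP; lia.
by have := b_colorable_bound hn ht lb l_gt5; case: ifP; lia.
Qed.
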